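(* Consider $n\ge 2$ agents in the plane and a stationary target $\bm{x}\in\mathbb{R}^2$, evolving under the target estimator and the controller described in the context. Then for every $i\in\mathcal{V}$ the tracking error $\delta_i(t)=d_i(t)-d^*=\|\bm{x}-\bm{p}_i(t)\|-d^*$ converges to zero exponentially fast as $t\to\infty$, i.e. there exist constants $C,\lambda>0$ such that $|\delta_i(t)|\le C e^{-\lambda t}$ for all $t\ge0$.
   Context: Agents: $\mathcal{V}=\{1,\dots,n\}$, $n\ge 2$. Agent $i$ has exactly one neighbor $j=j(i)$: $j=i+1$ if $i<n$, and $j=1$ if $i=n$. Agent $i$ has position $\bm{p}_i(t)\in\mathbb{R}^2$ with $\dot{\bm{p}}_i(t)=\bm{u}_i(t)$. The target position $\bm{x}\in\mathbb{R}^2$ is constant. All agents and the target occupy different locations at $t=0$, and the initial positions are such that no inter-agent collision occurs ($\bm{p}_i(t)\ne\bm{p}_{j}(t)$ for $i\neq j$, $t\ge0$). Measurements: $d_i(t)=\|\bm{x}-\bm{p}_i(t)\|$; $\bm{\varphi}_{iT}(t)=(\bm{x}-\bm{p}_i(t))/d_i(t)$; $\bar{\bm{\varphi}}_{iT}(t)$ is $\bm{\varphi}_{iT}(t)$ rotated clockwise by $\pi/2$; $\bm{\varphi}_{ij}(t)=(\bm{p}_j(t)-\bm{p}_i(t))/\|\bm{p}_j(t)-\bm{p}_i(t)\|$; $\psi_{ij}(t)\in[0,2\pi)$ is the counterclockwise angle from $\bm{\varphi}_{iT}(t)$ to $\bm{\varphi}_{ij}(t)$. Target estimator: $\dot{\hat{\bm{x}}}_i(t)=k_{est}\left(\bm{I}_2-\bm{\varphi}_{iT}(t)\bm{\varphi}_{iT}^\top(t)\right)(\bm{p}_i(t)-\hat{\bm{x}}_i(t))$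 with $k_{est}>0$. Angle estimate: $\hat\beta_{ij}(t)=2\psi_{ij}(t)-3\pi$ if $\psi_{ij}(t)\ge\pi$, and $\hat\beta_{ij}(t)=2\psi_{ij}(t)+\pi$ otherwise. Controller: $\bm{u}_i(t)=k_c(\hat d_i(t)-d^* )\bm{\varphi}_{iT}(t)+k_\omega(\alpha+\tilde\beta_i(t))\bar{\bm{\varphi}}_{iT}(t)$, where $\hat d_i(t)=\|\bm{p}_i(t)-\hat{\bm{x}}_i(t)\|$, $\tilde\beta_i(t)=\hat\beta_{ij}(t)-\beta_{ij}^*$, $d^*>0$ is the desired circumnavigation radius, $\beta_{ij}^*\in[0,2\pi)$ are the desired angular separations, $k_c,k_\omega>0$, and the constant $\alpha$ satisfies $\alpha-\sup_{i\in\mathcal{V},t\ge0}|\tilde\beta_i(t)|\ge\kappa_\alpha>0$ for some constant $\kappa_\alpha$. Solutions $(\bm{p}_i,\hat{\bm{x}}_i)_{i\in\mathcal{V}}$ are (locally absolutely continuous) functions on $[0,\infty)$ satisfying these equations (for almost every $t$), with all bearing vectors well defined, i.e. $d_i(t)>0$ for all $i$ and $t\ge0$. *)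

(* Defs.v *)
From mathcomp Require Import all_boot all_order all_algebra.
From mathcomp Require Import all_classical all_reals all_analysis.

Set Implicit Arguments.
Unset Strict Implicit.
Unset Printing Implicit Defensive.

Import Order.TTheory GRing.Theory Num.Theory.
Import numFieldNormedType.Exports.

Local Open Scope classical_set_scope.
Local Open Scope ring_scope.

(* The norm `|v| that MathComp-Analysis puts on matrices is the sup norm. *)
Definition enorm (R : realType) (v : 'cV[R]_2) : R :=
  Num.sqrt (\sum_k v k 0 ^+ 2).

(* Counterclockwise rotation by th. *)
Definition rotmx (R : realType) (th : R) : 'M[R]_2 :=
  \matrix_(r, c) if r == c then cos th
                 else if r == 0 then - sin th else sin th.

(* Unit vector pointing from p to q (0 when p = q). *)
Definition bearing (R : realType) (p q : 'cV[R]_2) : 'cV[R]_2 :=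
  (enorm (q - p))^-1 *: (q - p).

(* For unit vectors u and v exactly one psi satisfies the condition below. *)
Definition ccw_angle (R : realType) (u v : 'cV[R]_2) : R :=
  xget 0 [set psi | 0 <= psi < 2 * pi /\ v = rotmx psi *m u].

Definition angle_estimate (R : realType) (psi : R) : R :=
  if pi <= psi then 2 * psi - 3 * pi else 2 * psi + pi.

Definition abs_continuous (R : realType) (a b : R) (f : R -> 'cV[R]_2) : Prop :=
  forall e : R, 0 < e -> exists2 d : R, 0 < d &
    forall (m : nat) (s t : 'I_m -> R),
      (forall k, a <= s k /\ s k <= t k /\ t k <= b) ->
      trivIset [set: 'I_m] (fun k => `]s k, t k[%classic) ->
      \sum_k (t k - s k) < d ->
      \sum_k enorm (f (t k) - f (s k)) < e.

(* Functions on [0, +oo[ are represented by functions on R whose values at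
   negative arguments are irrelevant. *)
Definition loc_abs_continuous (R : realType) (f : R -> 'cV[R]_2) : Prop :=
  forall b : R, 0 <= b -> abs_continuous 0 b f.

Definition ae_ode (R : realType) (f f' : R -> 'cV[R]_2) : Prop :=
  {ae @lebesgue_measure R, forall t : R, 0 <= t -> is_derive t 1 f (f' t)}.

(* The single neighbor of agent i is ordS i, its cyclic successor in 'I_n. *)
Definition angle_error (R : realType) (n : nat) (x : 'cV[R]_2)
    (beta_star : 'I_n -> R) (p : 'I_n -> R -> 'cV[R]_2) (i : 'I_n) (t : R) : R :=
  angle_estimate
    (ccw_angle (bearing (p i t) x) (bearing (p i t) (p (ordS i) t)))
  - beta_star i.

Definition estimator_field (R : realType) (k_est : R)
    (x p xhat : 'cV[R]_2) : 'cV[R]_2 :=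
  let phi := bearing p x in
  k_est *: ((1%:M - phi *m phi^T) *m (p - xhat)).

Definition control (R : realType) (k_c k_w alpha d_star : R)
    (x p xhat : 'cV[R]_2) (beta_err : R) : 'cV[R]_2 :=
  let phi := bearing p x in
  (k_c * (enorm (p - xhat) - d_star)) *: phi
  + (k_w * (alpha + beta_err)) *: (rotmx (- (pi / 2)) *m phi).

Record closed_loop_solution (R : realType) (n : nat)
    (k_est k_c k_w alpha d_star : R) (beta_star : 'I_n -> R) (x : 'cV[R]_2)
    (p xhat : 'I_n -> R -> 'cV[R]_2) : Prop := {
  position_ac : forall i, loc_abs_continuous (p i);
  estimate_ac : forall i, loc_abs_continuous (xhat i);
  position_ode : forall i, ae_ode (p i)
    (fun t => control k_c k_w alpha d_star x (p i t) (xhat i t)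
                (angle_error x beta_star p i t));
  estimate_ode : forall i, ae_ode (xhat i)
    (fun t => estimator_field k_est x (p i t) (xhat i t));
  target_distance_gt0 : forall (i : 'I_n) (t : R), 0 <= t -> 0 < enorm (x - p i t)
}.

(* Main.v *)
Require Import Defs.
From mathcomp Require Import all_boot all_order all_algebra.
From mathcomp Require Import all_classical all_reals all_analysis.
From mathcomp Require Import ring lra.

(** Fix an agent at position p; let q = x - p, d = |q|, let z = xhat - x be the
    estimation error, and a, b the components of z along and across the line
    of sight q / d.  The controller gives d' = - k_c (dhat - d_star) with
    |dhat - d| <= |z|, and the line of sight rotates at the rate w / d, where
    w = k_w (alpha + error) stays in a compact interval [c1, c2] of positive
    numbers.  Since |z|^2 is nonincreasing, d and d' are bounded, but d has no
    a priori positive lower bound, so that the rotation may be arbitrarily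
    fast.  The weight d in the Lyapunov function W = |z|^2 - eps d a b makes up
    for this:
      W' = - 2 k_est b^2 - eps w (a^2 - b^2) + eps (k_est d - d') a b,
    which is at most - lam W for eps small.  Hence z, and then d - d_star,
    decays exponentially.  As the solutions are only absolutely continuous,
    monotonicity is deduced from the almost everywhere sign of the derivative,
    by a Cousin-type covering argument. *)

Import Order.TTheory GRing.Theory Num.Theory.
Import numFieldNormedType.Exports.

Set Implicit Arguments.
Unset Strict Implicit.
Unset Printing Implicit Defensive.

Local Open Scope classical_set_scope.
Local Open Scope ring_scope.

(** * Absolutely continuous functions *)

Definition ac (R : realType) (a b : R) (f : R -> R) : Prop :=
  forall e : R, 0 < e -> exists2 d : R, 0 < d &
    forall (m : nat) (s t : 'I_m -> R),
      (forall k, a <= s k /\ s k <= t k /\ t k <= b) ->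
      trivIset [set: 'I_m] (fun k => `]s k, t k[%classic) ->
      \sum_k (t k - s k) < d ->
      \sum_k `|f (t k) - f (s k)| < e.

Section AbsoluteContinuity.
Variable R : realType.
Implicit Types (a b c L : R) (f g h : R -> R).

(** The closure properties below all reduce to such a bound on increments. [L] may have any sign,
    since the proof replaces it by the positive constant [|L| + 1]. *)
Lemma ac_dominated2 a b L f g h : ac a b f -> ac a b g ->
  (forall s t, a <= s -> s <= t -> t <= b ->
     `|h t - h s| <= L * (`|f t - f s| + `|g t - g s|)) ->
  ac a b h.
Proof.
move=> acf acg hfg e e0.
pose L' := `|L| + 1.
have L'0 : 0 < L' by rewrite ltr_wpDl.
have e'0 : 0 < e / L' / 2 by rewrite !divr_gt0.
have [d1 d10 Hf] := acf _ e'0.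
have [d2 d20 Hg] := acg _ e'0.
exists (Num.min d1 d2); first by rewrite lt_min d10.
move=> m s t st triv; rewrite lt_min => /andP[sd1 sd2].
have {}Hf := Hf m s t st triv sd1.
have {}Hg := Hg m s t st triv sd2.
apply: (@le_lt_trans _ _
  (L' * (\sum_k `|f (t k) - f (s k)| + \sum_k `|g (t k) - g (s k)|))).
  rewrite -big_split /= mulr_sumr ler_sum // => k _.
  have [ask [skt tkb]] := st k.
  apply: (le_trans (hfg _ _ ask skt tkb)).
  by rewrite ler_wpM2r ?addr_ge0 // /L' (le_trans (ler_norm _)) // lerDl.
rewrite mulrC -ltr_pdivlMr // (splitr (e / L')).
exact: ltrD.
Qed.

Lemma ac_dominated a b L f h : ac a b f ->
  (forall s t, a <= s -> s <= t -> t <= b ->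
     `|h t - h s| <= L * `|f t - f s|) ->
  ac a b h.
Proof.
move=> acf H; apply: (@ac_dominated2 a b (`|L|) f f h acf acf) => s t as_ st tb.
apply: (le_trans (H _ _ as_ st tb)).
rewrite mulrDr (@le_trans _ _ (`|L| * `|f t - f s|)) //.
  by rewrite ler_wpM2r // ler_norm.
by rewrite lerDl mulr_ge0.
Qed.

Lemma ac_id a b : ac a b id.
Proof.
move=> e e0; exists e => // m s t st _.
rewrite (eq_bigr (fun k => `|t k - s k|)) // => k _.
by have [_ [? _]] := st k; rewrite ger0_norm // subr_ge0.
Qed.

Lemma ac_cst a b (c : R) : ac a b (fun=> c).
Proof.
by apply: (@ac_dominated a b 0 id) => [|s t *]; [exact: ac_id|rewrite subrr normr0 mul0r].
Qed.

Lemma ac_add a b f g : ac a b f -> ac a b g -> ac a b (fun t => f t + g t).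
Proof.
move=> acf acg; apply: (@ac_dominated2 a b 1 f g) => // s t _ _ _.
by rewrite mul1r opprD addrACA ler_normD.
Qed.

Lemma ac_opp a b f : ac a b f -> ac a b (fun t => - f t).
Proof.
move=> acf; apply: (@ac_dominated a b 1 f) => // s t _ _ _.
by rewrite mul1r -opprD normrN.
Qed.

Lemma ac_sub a b f g : ac a b f -> ac a b g -> ac a b (fun t => f t - g t).
Proof. by move=> acf acg; apply: ac_add => //; exact: ac_opp. Qed.

Lemma ac_uniformly_continuous a b f : ac a b f -> forall e, 0 < e ->
  exists2 d : R, 0 < d & forall s t, a <= s <= b -> a <= t <= b ->
    `|t - s| < d -> `|f t - f s| < e.
Proof.
move=> acf e e0; have [d d0 H] := acf e e0; exists d => // s t.
wlog st : s t / s <= t.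
  move=> W sab tab ts; have [/W|/ltW/W] := leP s t; first exact.
  by move=> H'; rewrite distrC H' // distrC.
move=> /andP[as_ sb] /andP[at_ tb] ts.
have := H 1%N (fun=> s) (fun=> t); rewrite !big_ord1; apply.
- by [].
- by apply/trivIsetP => i j _ _; rewrite !ord1 eqxx.
- by apply: le_lt_trans ts; rewrite ler_norm.
Qed.

Lemma ac_continuous a b f : ac a b f -> {within `[a, b], continuous f}.
Proof.
move=> acf; apply/subspace_continuousP => s sab.
apply/cvgrPdist_lt => e e0.
have [d d0 H] := ac_uniformly_continuous acf e0.
rewrite near_withinE; near=> t => tab.
rewrite distrC H // distrC; near: t.
Unshelve. all: end_near. Qed.

Lemma ac_bounded a b f : ac a b f ->
  exists2 M : R, 0 < M & forall t, a <= t <= b -> `|f t| <= M.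
Proof.
move=> acf; have [ab|ba] := leP a b; last first.
  by exists 1 => // t /andP[ta tb]; have := le_trans ta tb; rewrite leNgt ba.
have cf : {within `[a, b], continuous (fun t => `|f t|)}.
  apply: ac_continuous; apply: (@ac_dominated a b 1 f) => // s t _ _ _.
  by rewrite mul1r ler_dist_dist.
have [c _ H] := EVT_max ab cf.
exists (`|f c| + 1); first by rewrite ltr_wpDl.
move=> t tab; apply: (le_trans (H t _)); first by rewrite in_itv.
by rewrite lerDl.
Qed.

Lemma ac_bounded_below a b f : ac a b f -> a <= b ->
  (forall t, a <= t <= b -> 0 < f t) ->
  exists2 m : R, 0 < m & forall t, a <= t <= b -> m <= f t.
Proof.
move=> acf ab f0; have [c cab H] := EVT_min ab (ac_continuous acf).
exists (f c); first by apply: f0; move: cab; rewrite in_itv.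
by move=> t tab; apply: H; rewrite in_itv.
Qed.

(** Both factors are bounded on the compact interval, so the increments of the product are dominated
    with constant [M + N]. *)
Lemma ac_mul a b f g : ac a b f -> ac a b g -> ac a b (fun t => f t * g t).
Proof.
move=> acf acg.
have [M M0 Mf] := ac_bounded acf; have [N N0 Ng] := ac_bounded acg.
apply: (@ac_dominated2 a b (M + N) f g) => // s t as_ st tb.
have -> : f t * g t - f s * g s = (f t - f s) * g t + f s * (g t - g s) by ring.
apply: (le_trans (ler_normD _ _)); rewrite !normrM.
have Mfs : `|f s| <= M by rewrite Mf // as_ (le_trans st).
have Ngt : `|g t| <= N by rewrite Ng // tb andbT (le_trans as_).
have := normr_ge0 (f t - f s); have := normr_ge0 (g t - g s).
nra.
Qed.

(** By continuity [f] has a positive minimum [m], and inversion is Lipschitz with constant [m ^- 2]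
    on values at least [m]. *)
Lemma ac_inv a b f : ac a b f -> (forall t, a <= t <= b -> 0 < f t) ->
  ac a b (fun t => (f t)^-1).
Proof.
move=> acf f0; have [ab|ba] := leP a b; last first.
  apply: (@ac_dominated a b 0 f) => // s t as_ st tb.
  by have := le_trans as_ (le_trans st tb); rewrite leNgt ba.
have [m m0 mf] := ac_bounded_below acf ab f0.
apply: (@ac_dominated a b (m ^- 2) f) => // s t as_ st tb.
have tab : a <= t <= b by rewrite tb (le_trans as_).
have sab : a <= s <= b by rewrite as_ (le_trans st).
have ft0 := f0 _ tab; have fs0 := f0 _ sab.
have -> : (f t)^-1 - (f s)^-1 = - ((f t - f s) * ((f t)^-1 * (f s)^-1)).
  by field; rewrite !gt_eqF.
rewrite normrN normrM mulrC ler_wpM2r // ger0_norm; last first.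
  by rewrite mulr_ge0 ?invr_ge0 // ltW.
by rewrite -exprVn expr2 ler_pM ?invr_ge0 ?lef_pV2 ?posrE ?mf // ltW.
Qed.

(** The exponential is Lipschitz with constant [expR M] on values at most [M], by
    [1 + x <= expR x]. *)
Lemma ac_expR a b c : ac a b (fun t => expR (c * t)).
Proof.
have acl : ac a b (fun t => c * t) by apply: ac_mul; [exact: ac_cst|exact: ac_id].
have [M M0 HM] := ac_bounded acl.
have key x y : y <= M -> x <= y -> `|expR y - expR x| <= expR M * (y - x).
  move=> yM xy; rewrite ger0_norm ?subr_ge0 ?ler_expR //.
  have -> : expR x = expR y * expR (x - y) by rewrite -expRD addrC subrK.
  have := expR_ge1Dx (x - y); have : expR y <= expR M by rewrite ler_expR.
  have := expR_gt0 y; nra.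
apply: (@ac_dominated a b (expR M) _ _ acl) => s t as_ st tb.
have tM : c * t <= M by rewrite (le_trans (ler_norm _)) // HM // tb (le_trans as_).
have sM : c * s <= M by rewrite (le_trans (ler_norm _)) // HM // as_ (le_trans st).
have [xy|/ltW xy] := leP (c * s) (c * t).
  by rewrite [X in _ <= _ * X]ger0_norm ?subr_ge0 // key.
by rewrite distrC [X in _ <= _ * X]distrC [X in _ <= _ * X]ger0_norm ?subr_ge0 // key.
Qed.

End AbsoluteContinuity.

(** * Monotonicity from the sign of the derivative almost everywhere *)

(** Let [c] be the supremum of the points where [P] holds. A point of [P] in the left half of the
    window around [c] carries [P] to [min b (c + r / 2)], which cannot exceed [c] and hence equals
    [b]. *)
Lemma cousin_induction (R : realType) (a b : R) (P : R -> Prop) :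
  a <= b -> P a ->
  (forall c, a <= c <= b -> exists2 r : R, 0 < r & forall t u,
     a <= t -> u <= b -> c - r < t <= c -> c <= u < c + r -> P t -> P u) ->
  P b.
Proof.
move=> ab Pa step.
pose S := [set t | a <= t <= b /\ P t].
have Sa : S a by split; rewrite ?lexx.
have Sb : ubound S b by move=> t [/andP[]].
have hS : has_sup S by split; [exists a|exists b].
pose c := sup S.
have ac : a <= c by exact: (sup_ubound (proj2 hS) Sa).
have cb : c <= b by exact: (ge_sup (proj1 hS) Sb).
have [|r r0 H] := step c; first by rewrite ac cb.
have [t [/andP[at_ tb] Pt] ct] := sup_adherent r0 hS.
have tc : t <= c by apply: (sup_ubound (proj2 hS)); split; rewrite // at_.
pose u := Num.min b (c + r / 2).
have cu : c <= u by rewrite /u le_min cb lerDl divr_ge0 // ltW.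
have ur : u < c + r.
  by rewrite /u gt_min ltrD2l ltr_pdivrMr // ltr_pMr // ltr1n orbT.
have ub : u <= b by rewrite /u ge_min lexx.
have Pu : P u.
  by apply: (H t u) => //; rewrite ?cu ?ur // tc andbT.
have uc : u <= c by apply: (sup_ubound (proj2 hS)); split; rewrite // (le_trans ac).
suff <- : u = b by [].
rewrite /u; apply/min_idPl; rewrite leNgt; apply/negP => H'.
have : c + r / 2 <= c by move: uc; rewrite /u ge_min [b <= c](_ : _ = false) //; lra.
lra.
Qed.

Section Monotonicity.
Variable R : realType.
Local Notation mu := (@lebesgue_measure R).

(** Outer regularity is applied to a measurable null set [A] containing [N]; adding [A] back to [U]
    minus [A] costs no measure. *)
Lemma negligible_open_cover (N : set R) (e : R) : mu.-negligible N -> 0 < e ->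
  exists U : set R, [/\ open U, N `<=` U & (mu U < e%:E)%E].
Proof.
move=> [A [mA A0 NA]] e0.
have [|U [oU AU UA]] := lebesgue_regularity_outer mA _ e0.
  by rewrite [X in (X < _)%E](_ : _ = 0%E) //; exact: A0.

exists U; split => //; first exact: subset_trans AU.
have mU : measurable U by exact: measurable_realfun.open_measurable.
rewrite -(setDUK AU) measureU //; last 2 first.
- exact: measurableD.
- by rewrite setDIK.
by rewrite [X in (X + _)%E](_ : _ = 0%E) ?add0e //; exact: A0.
Qed.

Lemma sum_disjoint_itv (U : set R) (m : nat) (s t : 'I_m -> R) :
  open U -> (forall k, s k <= t k) -> (forall k, `]s k, t k[ `<=` U) ->
  trivIset setT (fun k => `]s k, t k[%classic) ->
  ((\sum_k (t k - s k))%:E <= mu U)%E.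
Proof.
move=> oU st sU triv.
have mI k : measurable (`]s k, t k[%classic : set R) by exact: measurable_itv.
apply: (@le_trans _ _ (mu (\big[setU/set0]_k `]s k, t k[%classic))).
  rewrite measure_bigsetU_ord // -sumEFin le_eqVlt; apply/orP; left; apply/eqP.
  apply: eq_bigr => k _; apply/esym; apply: (etrans (lebesgue_measure_itv _)).
  rewrite /= lte_fin.
  case: ltP => [//|ts]; have -> : t k = s k by apply/eqP; rewrite eq_le ts st.
  by rewrite subrr.
apply: le_measure; rewrite ?inE.
- by apply: bigsetU_measurable => k _; exact: mI.
- exact: measurable_realfun.open_measurable.
apply: (@big_ind _ (fun A : set R => A `<=` U)) => //.
by move=> A B AU BU y [/AU|/BU].
Qed.

(** In Caratheodory's form the slope [g] is continuous at [c] with value [df <= 0], hence at most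
    [e] nearby; the increment is split at [c]. *)
Lemma is_derive_le0_straddle (f : R -> R) (c df e : R) :
  is_derive c 1 f df -> df <= 0 -> 0 < e ->
  exists2 r : R, 0 < r & forall t u, c - r < t <= c -> c <= u < c + r ->
    f u - f t <= e * (u - t).
Proof.
move=> /is_derive1_caratheodory[g [fg cg gc]] df0 e0.
have /cvgrPdist_lt/(_ e e0) := cg.
rewrite gc => /nbhs_ballP[r r0 H].
have {}H z : c - r < z < c + r -> g z <= e.
  move=> /andP[cz zc]; have /ltW : `|df - g z| < e.
    by apply: H; rewrite /ball /= ltr_norml; apply/andP; split; lra.
  by rewrite ler_norml => /andP[]; lra.
exists r => // t u /andP[rt tc] /andP[cu ur].
have -> : f u - f t = (f u - f c) - (f t - f c) by ring.
rewrite !fg.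
have gu : g u <= e by apply: H; apply/andP; split; lra.
have gt : g t <= e by apply: H; apply/andP; split; lra.
nra.
Qed.

(** Near a point outside [N] the slope of [f] is almost nonpositive; points of [N] are absorbed by
    intervals of small total length, over which absolute continuity makes the variation small. *)
Lemma ac_nonincreasing (a b : R) (f : R -> R) (N : set R) :
  a <= b -> ac a b f -> mu.-negligible N ->
  (forall t, a <= t <= b -> ~ N t ->
     exists2 df : R, is_derive t 1 f df & df <= 0) ->
  f b <= f a.
Proof.
move=> ab acf N0 fN.
(* The first [e] is the slope tolerated outside [N], the second the variation tolerated near [N]. *)
suff key e : 0 < e -> f b - f a <= e * (b - a) + e.
  rewrite -subr_le0; apply/ler_addgt0Pr => e e0.
  have ba1 : 0 < b - a + 1 by rewrite ltr_wpDl // subr_ge0.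
  have := key (e / (b - a + 1)); rewrite divr_gt0 // => /(_ isT).
  suff -> : e / (b - a + 1) * (b - a) + e / (b - a + 1) = e by rewrite add0r.
  by field; rewrite gt_eqF.
move=> e0; have [d d0 acd] := acf e e0.
have [U [oU NU Ud]] := negligible_open_cover N0 d0.
(* [P t] is the bookkeeping up to time [t]: growth at slope [e], plus the increments over finitely
   many disjoint intervals inside [U]. *)
pose P t := exists m (s u : 'I_m -> R),
  [/\ forall k, a <= s k /\ s k <= u k /\ u k <= t,
      trivIset setT (fun k => `]s k, u k[%classic),
      forall k, `]s k, u k[ `<=` U
    & f t - f a <= e * (t - a) + \sum_k (f (u k) - f (s k))].
have : P b.
  apply: (@cousin_induction _ a b P) => //.
    exists 0%N, (fun=> 0), (fun=> 0); split => [[]//| |[]//|].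
      by apply/trivIsetP => -[].
    by rewrite big_ord0 !subrr mulr0 addr0.
  move=> c cab; have [Nc|/fN] := pselect (N c); last first.
    move=> /(_ cab)[df dfc df0].
    have [r r0 H] := is_derive_le0_straddle dfc df0 e0.
    exists r => // t u at_ ub tc cu [m [s [v [sv triv sU le]]]].
    exists m, s, v; split => //.
      move=> k; have [? [? ?]] := sv k; split => //; split => //.
      by move: tc cu => /andP[? ?] /andP[? ?]; lra.
    by have := H t u tc cu; lra.
  (* At a point of [N] the window lies in [U], and the interval from [t] to [u] joins the family at
     index [ord0]; the older intervals end by [t], which keeps the family disjoint. *)
  have /nbhs_ballP[r r0 rU] : nbhs c U by exact: open_nbhs_nbhs (conj oU (NU _ Nc)).
  exists r => // t u at_ ub /andP[rt tc] /andP[cu ur] [m [s [v [sv triv sU le]]]].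
  exists m.+1, (fun k => oapp s t (unlift ord0 k)), (fun k => oapp v u (unlift ord0 k)).
  have tu : t <= u by exact: le_trans cu.
  split.
  - move=> k; case: unliftP => [j _|_] /=; last by [].
    by have [? [? ?]] := sv j; split => //; split => //; lra.
  - have disj j : `]s j, v j[ `&` `]t, u[ = set0 :> set R.
      apply/seteqP; split => // y [] /=; rewrite !in_itv /= => /andP[_ yv] /andP[ty _].
      by have [_ [_ vt]] := sv j; lra.
    apply/trivIsetP => i j _ _.
    case: unliftP => [i' ->|->]; case: unliftP => [j' ->|->] //= ij.
    + by move/trivIsetP : triv; apply => //; apply: contraNneq ij => ->.
    + by rewrite setIC.
  - move=> k; case: unliftP => [j _|_] /= y; first exact: (sU j).
    rewrite /= in_itv /= => /andP[ty yu]; apply: rU.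
    by rewrite /ball /= ltr_norml; apply/andP; split; lra.
  rewrite big_ord_recl unlift_none /=.
  under eq_bigr do rewrite liftK /=.
  have : e * (t - a) <= e * (u - a) by rewrite ler_pM2l // lerB.
  lra.
(* The collected intervals have total length at most the measure of [U], hence below [d]. *)
move=> [m [s [v [sv triv sU le]]]]; apply: (le_trans le); rewrite lerD2l.
have svd : \sum_k (v k - s k) < d.
  rewrite -lte_fin; apply: le_lt_trans Ud.
  by apply: sum_disjoint_itv => // k; have [_ []] := sv k.
apply: le_trans (ltW (acd m s v sv triv svd)).
by apply: ler_sum => k _; exact: ler_norm.
Qed.

(** The integrating factor [expR (c * t)] makes the product nonincreasing. No sign is imposed on
    [c]. *)
Lemma gronwall_ae (f : R -> R) (c : R) :
  (forall b, 0 <= b -> ac 0 b f) ->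
  {ae mu, forall t : R, 0 <= t -> exists2 df : R, is_derive t 1 f df & df <= - c * f t} ->
  forall t, 0 <= t -> f t <= f 0 * expR (- (c * t)).
Proof.
move=> acf [N [mN N0 NP]] b b0.
pose g t := f t * expR (c * t).
have gb : g b <= g 0.
  apply: (@ac_nonincreasing 0 b g N) => //.
  - by apply: ac_mul; [exact: acf|exact: ac_expR].
  - by exists N; split.
  move=> t /andP[t0 _] Nt.
  have [df dft dfle] : exists2 df : R, is_derive t 1 f df & df <= - c * f t.
    by apply: contrapT => H; apply: Nt; apply: NP => /(_ t0).
  have dE : is_derive t 1 (fun t => expR (c * t)) (expR (c * t) * c).
    apply: is_derive1_comp.
    have := is_deriveZ c (is_derive_id t 1).
    by rewrite /GRing.scale /= mulr1.
  exists (f t * (expR (c * t) * c) + expR (c * t) * df).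
    exact: is_deriveM.
  by have := expR_gt0 (c * t); nra.
rewrite expRN -ler_pdivrMr ?invr_gt0 ?expR_gt0 // invrK.
by move: gb; rewrite /g mulr0 expR0 mulr1.
Qed.

End Monotonicity.

(** * The tracking error of one agent *)

Section PlaneNorm.
Variable R : realType.
Implicit Types a b c e : R.

Definition norm2 a b : R := Num.sqrt (a ^+ 2 + b ^+ 2).

Lemma norm2_ge0 a b : 0 <= norm2 a b.
Proof. exact: sqrtr_ge0. Qed.

Lemma sqr_norm2 a b : norm2 a b ^+ 2 = a ^+ 2 + b ^+ 2.
Proof. by rewrite sqr_sqrtr // addr_ge0 ?sqr_ge0. Qed.

Lemma norm2_le a b c : 0 <= c -> a ^+ 2 + b ^+ 2 <= c ^+ 2 -> norm2 a b <= c.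
Proof. by move=> c0 H; rewrite -(ler_pXn2r (ltn0Sn 1)) ?nnegrE ?norm2_ge0 // sqr_norm2. Qed.

(** This is Cauchy-Schwarz, from Lagrange's identity with remainder [(a * e - b * c) ^+ 2]. *)
Lemma norm2_triangle a b c e : norm2 (a + c) (b + e) <= norm2 a b + norm2 c e.
Proof.
apply: norm2_le; first by rewrite addr_ge0 ?norm2_ge0.
have := norm2_ge0 a b; have := norm2_ge0 c e.
have := sqr_norm2 a b; have := sqr_norm2 c e.
move: (norm2 a b) (norm2 c e) => x y ey ex y0 x0.
suff : a * c + b * e <= x * y by lra.
apply: le_trans (ler_norm _) _.
rewrite -(ler_pXn2r (ltn0Sn 1)) ?nnegrE ?mulr_ge0 //.
rewrite real_normK ?num_real // exprMn ex ey.
by have := sqr_ge0 (a * e - b * c); lra.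
Qed.

Lemma norm2_dist a b c e : `|norm2 a b - norm2 c e| <= norm2 (a - c) (b - e).
Proof.
have H1 := norm2_triangle (a - c) (b - e) c e.
have H2 := norm2_triangle (c - a) (e - b) a b.
have E : norm2 (c - a) (e - b) = norm2 (a - c) (b - e).
  by rewrite /norm2; congr Num.sqrt; ring.
move: H1 H2; rewrite !subrK E ler_norml => H1 H2; apply/andP; split; lra.
Qed.

Lemma norm2_le_abs a b : norm2 a b <= `|a| + `|b|.
Proof.
apply: norm2_le; first by rewrite addr_ge0.
rewrite -(real_normK (num_real a)) -(real_normK (num_real b)).
by have := normr_ge0 a; have := normr_ge0 b; nra.
Qed.

Lemma abs_le_norm2 a b : `|a| <= norm2 a b /\ `|b| <= norm2 a b.
Proof.
by split; rewrite -sqrtr_sqr ler_wsqrtr // ?lerDl ?lerDr sqr_ge0.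
Qed.

Lemma ac_norm2 (s t : R) (f g : R -> R) : ac s t f -> ac s t g ->
  ac s t (fun y => norm2 (f y) (g y)).
Proof.
move=> acf acg; apply: (@ac_dominated2 _ s t 1 f g) => // u v _ _ _.
by rewrite mul1r (le_trans (norm2_dist _ _ _ _)) // norm2_le_abs.
Qed.

Lemma is_derive_norm2 (f g : R -> R) (t df dg : R) :
  is_derive t 1 f df -> is_derive t 1 g dg -> 0 < norm2 (f t) (g t) ->
  is_derive t 1 (fun y => norm2 (f y) (g y))
    ((f t * df + g t * dg) / norm2 (f t) (g t)).
Proof.
move=> Df Dg n0.
have s0 : 0 < f t ^+ 2 + g t ^+ 2 by rewrite -sqr_norm2 exprn_gt0.
have Ds : is_derive t 1 (fun y => f y * f y + g y * g y)
    ((f t * df + f t * df) + (g t * dg + g t * dg)).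
  by apply: is_deriveD; exact: is_deriveM.
have -> : (fun y => norm2 (f y) (g y))
    = Num.sqrt \o (fun y => f y * f y + g y * g y) by [].
have := @is_derive1_sqrt R (f t * f t + g t * g t) s0.
move=> D; apply: (@is_derive_eq _ _ _ _ _ _ _ _ (@is_derive1_comp R _
  (fun y => f y * f y + g y * g y) _ _ _ D Ds)).
rewrite -[Num.sqrt _]/(norm2 (f t) (g t)); field; exact: lt0r_neq0.
Qed.

End PlaneNorm.

(** * Pointwise inequalities behind the Lyapunov function *)

Section LyapunovAlgebra.
Variable R : realType.

(** Of the damping [2 * k * b ^+ 2], one half absorbs the rotation and cross terms in [b], and the
    other gives the decay in [b]. The decay in [a] comes from the rotation, half of which pays for
    the cross term. *)
Lemma lyapunov_decrease (k eps w c1 c2 m M a b : R) :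
  0 < c1 -> 0 < eps -> c1 <= w <= c2 -> `|m| <= M ->
  eps * (c2 + M ^+ 2 / (2 * c1)) <= k -> eps * c1 <= k ->
  - 2 * k * b ^+ 2 - eps * w * a ^+ 2 + eps * w * b ^+ 2 + eps * m * (a * b)
    <= - (eps * c1 / 2) * (a ^+ 2 + b ^+ 2).
Proof.
move=> c10 e0 /andP[c1w wc2] mM He1 He2; have c1_ge0 := ltW c10.
have mM2 : m ^+ 2 <= M ^+ 2.
  by rewrite -(real_normK (num_real m)) ler_pXn2r ?nnegrE // (le_trans _ mM).
(* Young's inequality absorbs the cross term into the damping of [a] *)
have young : m * (a * b) <= c1 / 2 * a ^+ 2 + M ^+ 2 / (2 * c1) * b ^+ 2.
  have -> : c1 / 2 * a ^+ 2 + M ^+ 2 / (2 * c1) * b ^+ 2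
     = m * (a * b) + (c1 * a - m * b) ^+ 2 / (2 * c1)
        + (M ^+ 2 - m ^+ 2) * b ^+ 2 / (2 * c1).
    by field; rewrite gt_eqF.
  have H1 : 0 <= (c1 * a - m * b) ^+ 2 / (2 * c1).
    by apply: divr_ge0; [exact: sqr_ge0|rewrite mulr_ge0].
  have H2 : 0 <= (M ^+ 2 - m ^+ 2) * b ^+ 2 / (2 * c1).
    by apply: divr_ge0; [apply: mulr_ge0; rewrite ?subr_ge0 ?sqr_ge0|rewrite mulr_ge0].
  lra.
move: (M ^+ 2 / (2 * c1)) He1 young => K He1 young.
have a2 := sqr_ge0 a; have b2 := sqr_ge0 b.
have h1 : eps * (m * (a * b)) <= eps * (c1 / 2 * a ^+ 2 + K * b ^+ 2).
  by rewrite ler_pM2l.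
have h2 : eps * w * b ^+ 2 <= eps * c2 * b ^+ 2.
  by rewrite ler_wpM2r // ler_pM2l.
have h3 : eps * c1 * a ^+ 2 <= eps * w * a ^+ 2.
  by rewrite ler_wpM2r // ler_pM2l.
have h4 : eps * (c2 + K) * b ^+ 2 <= k * b ^+ 2 by rewrite ler_wpM2r.
have h5 : eps * c1 * b ^+ 2 <= k * b ^+ 2 by rewrite ler_wpM2r.
have h6 : 0 <= eps * c1 * b ^+ 2 by rewrite mulr_ge0 ?sqr_ge0 // mulr_ge0 // ltW.
lra.
Qed.

Lemma mul_le_half_sqr (a b : R) : `|a * b| <= (a ^+ 2 + b ^+ 2) / 2.
Proof.
have := sqr_ge0 (a - b); have := sqr_ge0 (a + b).
by rewrite ler_norml => H1 H2; apply/andP; split; lra.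
Qed.

End LyapunovAlgebra.

#[local] Instance ae_lebesgue_filter (R : realType) :
  Filter (nbhs (almost_everywhere (@lebesgue_measure R))).
Proof. exact: (ae_filter_ringOfSetsType (@lebesgue_measure R)). Qed.

(** * The Lyapunov argument for one agent, with an arbitrary bounded rotation [w] *)

Section SingleAgent.
Variables (R : realType) (k kc ds c1 c2 : R) (q0 q1 z0 z1 w : R -> R).
Hypotheses (k_gt0 : 0 < k) (kc_gt0 : 0 < kc) (ds_gt0 : 0 < ds) (c1_gt0 : 0 < c1).
Hypothesis w_bounds : forall t, 0 <= t -> c1 <= w t <= c2.
Hypothesis q0_ac : forall b, 0 <= b -> ac 0 b q0.
Hypothesis q1_ac : forall b, 0 <= b -> ac 0 b q1.
Hypothesis z0_ac : forall b, 0 <= b -> ac 0 b z0.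
Hypothesis z1_ac : forall b, 0 <= b -> ac 0 b z1.

Local Notation mu := (@lebesgue_measure R).
(** Since [q + z] is [xhat - p], its norm is the estimated distance. [S / d] and [B / d] are the
    components of [z] along the line of sight and along its clockwise normal. *)
Let d t := norm2 (q0 t) (q1 t).
Let A t := kc * (norm2 (q0 t + z0 t) (q1 t + z1 t) - ds).
Let B t := q1 t * z0 t - q0 t * z1 t.
Let S t := q0 t * z0 t + q1 t * z1 t.
Let Z t := z0 t ^+ 2 + z1 t ^+ 2.

Hypothesis d_gt0 : forall t, 0 <= t -> 0 < d t.
Hypothesis ode : {ae mu, forall t : R, 0 <= t ->
  [/\ is_derive t 1 q0 (- A t * q0 t / d t - w t * q1 t / d t),
      is_derive t 1 q1 (- A t * q1 t / d t + w t * q0 t / d t),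
      is_derive t 1 z0 (- k * B t * q1 t / d t ^+ 2)
    & is_derive t 1 z1 (k * B t * q0 t / d t ^+ 2)]}.

Let dsqr t : d t ^+ 2 = q0 t ^+ 2 + q1 t ^+ 2.
Proof. exact: sqr_norm2. Qed.

Let Z_ge0 t : 0 <= Z t.
Proof. by rewrite addr_ge0 ?sqr_ge0. Qed.

Let d_ac b : 0 <= b -> ac 0 b d.
Proof. by move=> b0; apply: ac_norm2; [exact: q0_ac|exact: q1_ac]. Qed.

Let Z_ac b : 0 <= b -> ac 0 b Z.
Proof.
move=> b0; apply: (@ac_add _ 0 b (fun t => z0 t * z0 t) (fun t => z1 t * z1 t)).
  by apply: ac_mul; exact: z0_ac.
by apply: ac_mul; exact: z1_ac.
Qed.

(** The tangential velocity is orthogonal to [q] and drops out. *)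
Let derive_d : {ae mu, forall t : R, 0 <= t -> is_derive t 1 d (- A t)}.
Proof.
apply: filterS ode => t H t0; have [Dq0 Dq1 _ _] := H t0.
have dt0 := d_gt0 t0; have ds2 := dsqr t.
apply: is_derive_eq (is_derive_norm2 Dq0 Dq1 dt0) _.
rewrite -/(d t).
have -> : q0 t * (- A t * q0 t / d t - w t * q1 t / d t)
  + q1 t * (- A t * q1 t / d t + w t * q0 t / d t)
  = - A t * (q0 t ^+ 2 + q1 t ^+ 2) / d t by field; rewrite gt_eqF.
by rewrite -ds2; field; rewrite gt_eqF.
Qed.

(** Only the component across the line of sight is damped directly, so [Z] alone yields monotonicity
    but no rate. *)
Let derive_Z : {ae mu, forall t : R, 0 <= t ->
  is_derive t 1 Z (- 2 * k * (B t / d t) ^+ 2)}.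
Proof.
apply: filterS ode => t H t0; have [_ _ Dz0 Dz1] := H t0.
have dt0 := d_gt0 t0.
apply: is_derive_eq (is_deriveD (is_deriveM Dz0 Dz0) (is_deriveM Dz1 Dz1)) _.
by rewrite /GRing.scale /= /B; field; rewrite gt_eqF.
Qed.

Let Z_le t : 0 <= t -> Z t <= Z 0.
Proof.
(* Rate zero turns the Gronwall bound into monotonicity. *)
move=> t0; suff : Z t <= Z 0 * expR (- (0 * t)) by rewrite mul0r oppr0 expR0 mulr1.
apply: gronwall_ae t0; first exact: Z_ac.
apply: filterS derive_Z => y H y0; exists (- 2 * k * (B y / d y) ^+ 2); first exact: H.
rewrite oppr0 mul0r -mulrA mulNr oppr_le0.
by rewrite mulr_ge0 // mulr_ge0 ?sqr_ge0 // ltW.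
Qed.

Let estimate_gap t : `|norm2 (q0 t + z0 t) (q1 t + z1 t) - d t| <= norm2 (z0 t) (z1 t).
Proof.
apply: le_trans (norm2_dist _ _ _ _) _.
by rewrite [q0 t + _]addrC [q1 t + _]addrC !addrK.
Qed.

Let r0 := norm2 (z0 0) (z1 0).

Let gap_le t : 0 <= t -> norm2 (z0 t) (z1 t) <= r0.
Proof. by move=> t0; rewrite ler_wsqrtr // Z_le. Qed.

Let D := ds + r0 + d 0.

Let D_gt0 : 0 < D.
Proof. by rewrite !ltr_wpDr ?norm2_ge0. Qed.

(** The estimated distance is at least [d - r0], so [d - (ds + r0)] satisfies a Gronwall inequality
    at rate [kc]. *)
Let d_le t : 0 <= t -> d t <= D.
Proof.
move=> t0.
have : d t - (ds + r0) <= (d 0 - (ds + r0)) * expR (- (kc * t)).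
  have /= := @gronwall_ae _ (fun t => d t - (ds + r0)) kc; apply => //.
    by move=> b b0; apply: ac_sub; [exact: d_ac|exact: ac_cst].
  apply: filterS derive_d => y H y0; exists (- A y).
    have := is_deriveB (H y0) (is_derive_cst (ds + r0) y 1).
    by rewrite subr0.
  rewrite /A mulNr lerN2 ler_pM2l //.
  by have := estimate_gap y; have := gap_le y0; rewrite ler_norml => ? /andP[]; lra.
have E1 : expR (- (kc * t)) <= 1 by rewrite -expR0 ler_expR oppr_le0 mulr_ge0 // ltW.
have E0 := expR_gt0 (- (kc * t)).
have h1 : d 0 * expR (- (kc * t)) <= d 0 by rewrite ler_piMr ?norm2_ge0.
have h2 : 0 <= (ds + r0) * expR (- (kc * t)).
  by rewrite mulr_ge0 ?addr_ge0 ?norm2_ge0 // ltW.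
rewrite mulrBl /D; lra.
Qed.

(** Bound for [A + k * d], the coefficient of the cross term in the derivative of [W]. *)
Let M := kc * (D + r0 + ds) + k * D.

Let speed_bound t : 0 <= t -> `|A t + k * d t| <= M.
Proof.
move=> t0; have d0 := d_gt0 t0; have dD := d_le t0.
have g := gap_le t0; have := estimate_gap t; rewrite ler_norml => /andP[g1 g2].
have n0 : 0 <= norm2 (q0 t + z0 t) (q1 t + z1 t) by exact: norm2_ge0.
have h1 : k * d t <= k * D by rewrite ler_pM2l.
have h2 : 0 <= k * d t by rewrite mulr_ge0 // ltW.
have r00 : 0 <= r0 by exact: norm2_ge0.
have D0 := D_gt0; have ds0 := ds_gt0.
have h3 : A t <= kc * (D + r0 + ds) by rewrite ler_pM2l //; lra.
have h4 : - (kc * (D + r0 + ds)) <= A t by rewrite -mulrN ler_pM2l //; lra.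
by rewrite ler_norml; apply/andP; split; rewrite /M; lra.
Qed.

(** The denominator sums all positive quantities that [eps] has to control; each condition in
    [eps_spec] follows by dropping the other summands. *)
Let eps := k / (k * D + c2 + M ^+ 2 / (2 * c1) + c1).

Let c2_gt0 : 0 < c2.
Proof. have /andP[c1w wc2] := w_bounds (lexx 0).
exact: lt_le_trans c1_gt0 (le_trans c1w wc2). Qed.

Let eps_spec : [/\ 0 < eps, eps * D <= 1, eps * c1 <= k
  & eps * (c2 + M ^+ 2 / (2 * c1)) <= k].
Proof.
have K0 : 0 <= M ^+ 2 / (2 * c1) by rewrite divr_ge0 ?sqr_ge0 // mulr_ge0 // ltW.
rewrite /eps; move: (M ^+ 2 / (2 * c1)) K0 => K K0.
have kD : 0 < k * D by rewrite mulr_gt0.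
have c20 := c2_gt0; have c10 := c1_gt0.
have den0 : 0 < k * D + c2 + K + c1 by lra.
have H x : x <= k * D + c2 + K + c1 -> k / (k * D + c2 + K + c1) * x <= k.
  by move=> Hx; rewrite mulrAC ler_pdivrMr // ler_pM2l.
split; [exact: divr_gt0| |by apply: H; lra|by apply: H; lra].
by rewrite mulrAC ler_pdivrMr //; lra.
Qed.

(* With [a], [b] the components of the estimation error along and across the
   line of sight, [S * B / d = d * a * b]; this term transfers the damping of
   [b] to [a], because the line of sight rotates at the rate [w / d]. *)
Let W t := Z t - eps * (S t * B t / d t).

Let components t : 0 <= t -> (S t / d t) ^+ 2 + (B t / d t) ^+ 2 = Z t.
Proof.
move=> t0; have d0 := d_gt0 t0.
have -> : (S t / d t) ^+ 2 + (B t / d t) ^+ 2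
   = (q0 t ^+ 2 + q1 t ^+ 2) * Z t / d t ^+ 2.
  by rewrite /S /B /Z; field; rewrite gt_eqF.
by rewrite -dsqr mulrAC divff ?mul1r // expf_neq0 // gt_eqF.
Qed.

(** The cross term is at most [eps * d * Z / 2] in absolute value, and [eps * d <= eps * D <= 1]. *)
Let W_equiv t : 0 <= t -> Z t / 2 <= W t <= 3 / 2 * Z t.
Proof.
move=> t0; have d0 := d_gt0 t0; have dD := d_le t0.
have [e0 eD _ _] := eps_spec.
have -> : W t = Z t - eps * d t * (S t / d t * (B t / d t)).
  by rewrite /W; field; rewrite gt_eqF.
have := mul_le_half_sqr (S t / d t) (B t / d t).
rewrite components // ler_norml; move: (S t / d t * (B t / d t)) => y /andP[y1 y2].
have ed1 : eps * d t <= 1 by apply: le_trans eD; rewrite ler_pM2l.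
have ed0 : 0 < eps * d t by rewrite mulr_gt0.
have Zt0 := Z_ge0 t.
apply/andP; split; nra.
Qed.

Let W_ac b : 0 <= b -> ac 0 b W.
Proof.
move=> b0; have q0a := q0_ac b0; have q1a := q1_ac b0.
have z0a := z0_ac b0; have z1a := z1_ac b0.
apply: ac_sub; first exact: Z_ac.
apply: ac_mul; first exact: ac_cst.
apply: ac_mul.
  by apply: ac_mul; [apply: ac_add|apply: ac_sub]; exact: ac_mul.
by apply: ac_inv; [exact: d_ac|move=> t /andP[t0 _]; exact: d_gt0].
Qed.

(** The derivative is at most [- (eps * c1 / 2) * Z], and [Z] is at least two thirds of [W], whence
    the rate [eps * c1 / 3]. *)
Let W_decay t : 0 <= t -> W t <= W 0 * expR (- (eps * c1 / 3 * t)).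
Proof.
apply: gronwall_ae W_ac _ t.
apply: filterS3 ode derive_d derive_Z => t H Hd HZ t0.
have [Dq0 Dq1 Dz0 Dz1] := H t0.
have {}Hd := Hd t0; have {}HZ := HZ t0.
have d0 := d_gt0 t0; have dn0 : d t != 0 by rewrite gt_eqF.
have ds2 := dsqr t.
have DS : is_derive t 1 S (- A t * S t / d t - w t * B t / d t).
  apply: is_derive_eq (is_deriveD (is_deriveM Dq0 Dz0) (is_deriveM Dq1 Dz1)) _.
  by rewrite /GRing.scale /= /S /B; field.
have DB : is_derive t 1 B (- A t * B t / d t + w t * S t / d t - k * B t).
  apply: is_derive_eq (is_deriveB (is_deriveM Dq1 Dz0) (is_deriveM Dq0 Dz1)) _.
  rewrite /GRing.scale /=.
  have -> : - A t * B t / d t + w t * S t / d t - k * B t =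
    - A t * B t / d t + w t * S t / d t - k * B t * (q0 t ^+ 2 + q1 t ^+ 2) / d t ^+ 2.
    by rewrite -ds2 mulfK // expf_neq0.
  by rewrite /S /B; field.
have DG := is_deriveM (is_deriveM DS DB) (is_deriveV dn0 Hd).
have DW := is_deriveB HZ (is_deriveZ eps DG).
(* In terms of the components [S / d] and [B / d], every negative power of [d] has cancelled. *)
exists (- 2 * k * (B t / d t) ^+ 2 - eps * w t * (S t / d t) ^+ 2
   + eps * w t * (B t / d t) ^+ 2
   + eps * (A t + k * d t) * (S t / d t * (B t / d t))).
  apply: is_derive_eq DW _.
  by rewrite /GRing.scale /= -[(S * B) t]/(S t * B t); field.
have [e0 _ e1 e2] := eps_spec.
apply: le_trans (lyapunov_decrease (S t / d t) (B t / d t) c1_gt0 e0 (w_bounds t0)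
  (speed_bound t0) e2 e1) _.
rewrite components //.
have /andP[_ W32] := W_equiv t0.
have : 0 < eps * c1 by rewrite mulr_gt0.
nra.
Qed.

Lemma single_agent_convergence : exists C lam : R, 0 < C /\ 0 < lam /\
  forall t : R, 0 <= t -> `|d t - ds| <= C * expR (- (lam * t)).
Proof.
have [e0 _ _ _] := eps_spec.
(* The norm of [z] decays at half the rate of [W]; the bound [kc / 2] leaves room in the comparison
   below. *)
pose m := Num.min (eps * c1 / 6) (kc / 2).
have m0 : 0 < m by rewrite lt_min; apply/andP; split; apply: divr_gt0 => //; apply: mulr_gt0.
have m1 : m <= eps * c1 / 6 by rewrite ge_min lexx.
have m2 : m <= kc / 2 by rewrite ge_min lexx orbT.
have W0 : 0 <= W 0.
  by have /andP[H _] := W_equiv (lexx 0); apply: le_trans H; rewrite divr_ge0.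
(* From [Z <= 2 * W] and the decay of [W]. *)
pose K := Num.sqrt (2 * W 0).
have K0 : 0 <= K by exact: sqrtr_ge0.
have gap_decay t : 0 <= t -> norm2 (z0 t) (z1 t) <= K * expR (- (m * t)).
  move=> t0; apply: norm2_le; first by rewrite mulr_ge0 // expR_ge0.
  rewrite -/(Z t) exprMn sqr_sqrtr ?mulr_ge0 // -expRM_natl.
  have /andP[Hz _] := W_equiv t0; have Hw := W_decay t0.
  have : expR (- (eps * c1 / 3 * t)) <= expR (2%:R * - (m * t)).
    have mt : m * t <= eps * c1 / 6 * t by rewrite ler_wpM2r.
    by rewrite ler_expR; lra.
  by move: (expR _) (expR _) Hw => E F Hw EF; nra.
(* The sign [s] treats the upper and the lower bound on [d - ds] at once. *)
have comparison s : s ^+ 2 = 1 -> forall t, 0 <= t ->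
  s * (d t - ds) <= (2 * K + `|d 0 - ds|) * expR (- (m * t)).
  move=> s2 t t0.
  have s1 : `|s| = 1 by apply/eqP; rewrite -sqr_norm_eq1 s2.
  (* With the factor 2, one [kc * K * expR (- m * t)] offsets the estimation gap, and the other the
     derivative of the exponential, as [2 * m <= kc]. *)
  pose f t := s * (d t - ds) - 2 * K * expR (- m * t).
  have : f t <= f 0 * expR (- (kc * t)).
    apply: gronwall_ae t0.
      move=> b b0; apply: ac_sub; apply: ac_mul; rewrite ?ac_cst //.
      + exact: ac_cst.
      + by apply: ac_sub; [exact: d_ac|exact: ac_cst].
      + exact: ac_cst.
      + exact: ac_expR.
    apply: filterS derive_d => y H y0; have {}H := H y0.
    have Dl : is_derive y 1 (fun y => - m * y) (- m).
      have := is_deriveZ (- m) (is_derive_id y 1).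
      by rewrite /GRing.scale /= mulr1.
    have De := is_derive1_comp (is_derive_expR (- m * y)) Dl.
    have D1 := is_deriveZ s (is_deriveB H (is_derive_cst ds y 1)).
    have D2 := is_deriveZ (2 * K) De.
    exists (s * (- A y - 0) - 2 * K * (expR (- m * y) * - m)).
      exact: is_deriveB D1 D2.
    have g := estimate_gap y; have gd := gap_decay _ y0.
    have : s * (d y - norm2 (q0 y + z0 y) (q1 y + z1 y)) <= K * expR (- (m * y)).
      apply: le_trans gd; apply: le_trans g; apply: le_trans (ler_norm _) _.
      by rewrite normrM s1 mul1r distrC.
    rewrite /f /A mulNr.
    have E0 := expR_gt0 (- (m * y)).
    move: (expR _) E0 => E E0 H1.
    have KE : 0 <= K * E by rewrite mulr_ge0 // ltW.
    have : kc * (s * (d y - norm2 (q0 y + z0 y) (q1 y + z1 y))) <= kc * (K * E).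
      by rewrite ler_pM2l.
    have : m * (K * E) <= kc / 2 * (K * E) by rewrite ler_wpM2r.
    lra.
  rewrite /f mulr0 expR0 mulr1 mulNr => H.
  have E : expR (- (kc * t)) <= expR (- (m * t)).
    by rewrite ler_expR lerN2 ler_wpM2r //; lra.
  have h1 : s * (d 0 - ds) <= `|d 0 - ds|.
    by apply: le_trans (ler_norm _) _; rewrite normrM s1 mul1r.
  have := expR_gt0 (- (kc * t)); have := normr_ge0 (d 0 - ds).
  nra.
(* The summand 1 makes the constant strictly positive even when the other two vanish. *)
exists (2 * K + `|d 0 - ds| + 1), m; split; first by rewrite ltr_wpDl ?addr_ge0 ?mulr_ge0.
split=> // t t0; apply: (@le_trans _ _ ((2 * K + `|d 0 - ds|) * expR (- (m * t)))).
  have H1 := comparison 1 (expr1n _ _) t t0.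
  have H2 : -1 * (d t - ds) <= _ := comparison (-1) (etrans (sqrrN 1) (expr1n _ _)) t t0.
  by rewrite ler_norml; apply/andP; split; lra.
by rewrite ler_wpM2r ?expR_ge0 // lerDl.
Qed.

End SingleAgent.

(** * Coordinates of the closed loop *)

Section Coordinates.
Variable R : realType.

Lemma enormE (v : 'cV[R]_2) : enorm v = norm2 (v 0 0) (v 1 0).
Proof.
rewrite /enorm /norm2 !big_ord_recl big_ord0 addr0.
by have -> : lift ord0 ord0 = 1 :> 'I_2 by exact: val_inj.
Qed.

Lemma ac_coord (a b : R) (f : R -> 'cV[R]_2) (k : 'I_2) :
  abs_continuous a b f -> ac a b (fun t => f t k 0).
Proof.
move=> acf e e0; have [d d0 H] := acf e e0; exists d => // m s t st triv sd.
apply: le_lt_trans (H m s t st triv sd); apply: ler_sum => l _.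
rewrite enormE !mxE; have [h0 h1] := abs_le_norm2 (f (t l) 0 0 - f (s l) 0 0)
  (f (t l) 1 0 - f (s l) 1 0).
have [->//|->//] : k = 0 \/ k = 1.
by case: k => -[|[|//]] ?; [left|right]; exact: val_inj.
Qed.

Lemma is_derive_coord (f : R -> 'cV[R]_2) (t : R) (v : 'cV[R]_2) (k : 'I_2) :
  is_derive t 1 f v -> is_derive t 1 (fun s => f s k 0) (v k 0).
Proof.
move=> [df <-]; apply: DeriveDef; first by move/derivable_mxP : df; exact.
by rewrite derive_mx // mxE.
Qed.

Lemma control_coord (k_c k_w alpha d_star : R) (x p xhat : 'cV[R]_2) (err : R)
    (q := x - p) (d := enorm q) (A := k_c * (enorm (p - xhat) - d_star))
    (w := k_w * (alpha + err)) :
  let u := control k_c k_w alpha d_star x p xhat err in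
  u 0 0 = A * q 0 0 / d + w * q 1 0 / d /\ u 1 0 = A * q 1 0 / d - w * q 0 0 / d.
Proof.
rewrite /control /bearing -/q -/d -/A -/w /rotmx.
have l1 : lift ord0 ord0 = 1 :> 'I_2 by exact: val_inj.
rewrite cosN sinN cos_pihalf sin_pihalf.
by split; rewrite !mxE !big_ord_recl big_ord0 l1 !mxE /=; ring.
Qed.

Lemma estimator_field_coord (k : R) (x p xhat : 'cV[R]_2)
    (q := x - p) (z := xhat - x) (d := enorm q)
    (B := q 1 0 * z 0 0 - q 0 0 * z 1 0) : 0 < d ->
  let v := estimator_field k x p xhat in
  v 0 0 = - k * B * q 1 0 / d ^+ 2 /\ v 1 0 = k * B * q 0 0 / d ^+ 2.
Proof.
move=> d0; have dn0 : d != 0 by rewrite gt_eqF.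
(* Writing the diagonal entries of the identity this way makes the projection formula a rational
   identity in independent variables. *)
have d2 : 1 = (q 0 0 ^+ 2 + q 1 0 ^+ 2) / d ^+ 2.
  by rewrite -sqr_norm2 -enormE divff // expf_neq0.
have -> : estimator_field k x p xhat =
  k *: ((1%:M - bearing p x *m (bearing p x)^T) *m (- q - z)).
  rewrite /estimator_field; congr (_ *: (_ *m _)).
  by rewrite /q /z; apply/colP => j; rewrite !mxE; ring.
have l1 : lift ord0 ord0 = 1 :> 'I_2 by exact: val_inj.
rewrite /B /bearing -/q -/d; clearbody q z d.
split; rewrite !mxE !big_ord_recl big_ord0 l1 !mxE !big_ord_recl !big_ord0 !mxE /=
  ?mulr1n ?mulr0n d2; field; exact: dn0.
Qed.

(** The default value 0 of [xget] lies in the range too, which covers vectors with no admissible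
    angle. *)
Lemma ccw_angle_bounds (u v : 'cV[R]_2) : 0 <= ccw_angle u v <= 2 * pi.
Proof.
rewrite /ccw_angle; case: xgetP => [psi _ [/andP[psi0 psi2] _]|_].
  by rewrite psi0 ltW.
by rewrite lexx mulr_ge0 ?pi_ge0.
Qed.

(** A crude bound: it serves to make the supremum in the condition on [alpha] a genuine upper bound
    of the errors. *)
Lemma angle_error_bounded (n : nat) (x : 'cV[R]_2) (beta_star : 'I_n -> R)
    (p : 'I_n -> R -> 'cV[R]_2) (i : 'I_n) (t : R) :
  0 <= beta_star i < 2 * pi -> `|angle_error x beta_star p i t| <= 5 * pi.
Proof.
move=> /andP[b0 b2]; rewrite /angle_error /angle_estimate.
have := ccw_angle_bounds (bearing (p i t) x) (bearing (p i t) (p (ordS i) t)).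
move: (ccw_angle _ _) => psi /andP[psi0 psi2].
have pi0 : 0 <= pi :> R by exact: pi_ge0.
by case: (leP pi psi) => ?; rewrite ler_norml; apply/andP; split; lra.
Qed.

End Coordinates.

(** The neighbor acts on an agent only through [angle_error], of which only bounds are used; each
    agent can thus be treated alone. *)
Theorem mainTheorem2 (R : realType) (n : nat) (n_ge2 : (2 <= n)%N)
    (k_est k_c k_w alpha kappa d_star : R) (beta_star : 'I_n -> R)
    (x : 'cV[R]_2) (p xhat : 'I_n -> R -> 'cV[R]_2)
    (k_est_gt0 : 0 < k_est) (k_c_gt0 : 0 < k_c) (k_w_gt0 : 0 < k_w)
    (d_star_gt0 : 0 < d_star)
    (beta_star_range : forall i : 'I_n, 0 <= beta_star i < 2 * pi)
    (target_neq0 : forall i : 'I_n, p i 0 != x)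
    (agents_neq0 : forall i j : 'I_n, i != j -> p i 0 != p j 0)
    (no_collision : forall (i j : 'I_n) (t : R), i != j -> 0 <= t -> p i t != p j t)
    (sol : closed_loop_solution k_est k_c k_w alpha d_star beta_star x p xhat)
    (kappa_gt0 : 0 < kappa)
    (alpha_bound : kappa <= alpha -
       sup [set r : R | exists (i : 'I_n) (t : R), 0 <= t /\
                          r = `|angle_error x beta_star p i t| ]) :
  forall i : 'I_n, exists C lambda : R, 0 < C /\ 0 < lambda /\
    forall t : R, 0 <= t ->
      `|enorm (x - p i t) - d_star| <= C * expR (- (lambda * t)).
Proof.
move=> i; have [pac xac pode xode d_gt0] := sol.
set E := [set r | _] in alpha_bound.
have err_le t : 0 <= t -> `|angle_error x beta_star p i t| <= alpha - kappa.
  move=> t0; apply: (@le_trans _ _ (sup E)); last lra.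
  apply: ub_le_sup; last by exists i, t.
  by exists (5 * pi) => _ [j [s [_ ->]]]; exact: angle_error_bounded.
pose q a t := x a 0 - p i t a 0.
pose z a t := xhat i t a 0 - x a 0.
have enorm_q t : enorm (x - p i t) = norm2 (q 0 t) (q 1 t) by rewrite enormE !mxE.
have enorm_est t : enorm (p i t - xhat i t) = norm2 (q 0 t + z 0 t) (q 1 t + z 1 t).
  rewrite enormE !mxE /q /z; set a := p i t 0 0; set b := p i t 1 0.
  by rewrite /norm2; congr Num.sqrt; ring.
pose w t := k_w * (alpha + angle_error x beta_star p i t).
(* An error of size at most [alpha - kappa] puts [alpha] plus the error between [kappa] and
   [2 * alpha - kappa]. *)
have w_bounds t : 0 <= t -> k_w * kappa <= w t <= k_w * (2 * alpha - kappa).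
  move=> /err_le; rewrite ler_norml => /andP[e1 e2].
  by apply/andP; split; rewrite ler_pM2l //; lra.
have q_ac a b : 0 <= b -> ac 0 b (q a).
  by move=> b0; apply: ac_sub; [exact: ac_cst|apply: ac_coord; exact: pac].
have z_ac a b : 0 <= b -> ac 0 b (z a).
  by move=> b0; apply: ac_sub; [apply: ac_coord; exact: xac|exact: ac_cst].
have q_gt0 t : 0 <= t -> 0 < norm2 (q 0 t) (q 1 t).
  by rewrite -enorm_q; exact: d_gt0.
have := @single_agent_convergence R k_est k_c d_star (k_w * kappa)
  (k_w * (2 * alpha - kappa)) (q 0) (q 1) (z 0) (z 1) w k_est_gt0 k_c_gt0 d_star_gt0
  (mulr_gt0 k_w_gt0 kappa_gt0) w_bounds (q_ac 0) (q_ac 1) (z_ac 0) (z_ac 1) q_gt0.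
case.
  apply: filterS2 (pode i) (xode i) => t Hp Hx t0.
  have Dq a : is_derive t 1 (q a) (0 - control k_c k_w alpha d_star x (p i t)
      (xhat i t) (angle_error x beta_star p i t) a 0).
    by apply: is_deriveB; apply: is_derive_coord; exact: Hp.
  have Dz a : is_derive t 1 (z a)
      (estimator_field k_est x (p i t) (xhat i t) a 0 - 0).
    by apply: is_deriveB; apply: is_derive_coord; exact: Hx.
  have [u0 u1] := control_coord k_c k_w alpha d_star x (p i t) (xhat i t)
    (angle_error x beta_star p i t).
  have [v0 v1] := estimator_field_coord k_est (xhat i t) (d_gt0 i t t0).
  have qE a : (x - p i t) a 0 = q a t by rewrite !mxE.
  have zE a : (xhat i t - x) a 0 = z a t by rewrite !mxE.
  rewrite enorm_q enorm_est !qE -/(w t) in u0 u1.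
  rewrite enorm_q !qE !zE in v0 v1.
  split.
  - by apply: is_derive_eq (Dq 0) _; rewrite u0; ring.
  - by apply: is_derive_eq (Dq 1) _; rewrite u1; ring.
  - by apply: is_derive_eq (Dz 0) _; rewrite subr0 v0.
  - by apply: is_derive_eq (Dz 1) _; rewrite subr0 v1.
move=> C [lam [C0 [lam0 H]]]; exists C, lam; split=> //; split=> // t t0.
by rewrite enorm_q; exact: H.
Qed.
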